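(* Let $n\ge 0$, let $L=\partial^{n+1}+\sum_{i=0}^na_i\partial^i\in\mathbb{Q}(z)[\partial]$ be irreducible and satisfy properties (M) and (P), and suppose that $0$ is the only exponent of $L$ at $z=0$. Let $y_0,\dots,y_n$ be a flag of $L$ at $z=0$. Put $\mathcal{N}_0:=1$ and, for $0\le k\le n$, \[\mathcal{N}_{k+1}:=\vartheta\,\frac{1}{\mathcal{N}_k(y_k)}\,\mathcal{N}_k .\] Then (these operators are well defined and) $\mathcal{N}_j\in\mathbb{Q}\llbracket z\rrbracket[\vartheta]$ for all $0\le j\le n+1$, and $\mathcal{N}_j(y_i)=0$ for all $0\le i\le j-1$.
   Context: Here $\partial=\frac{d}{dz}$ and $\vartheta=z\frac{d}{dz}$. Operators in $\mathbb{C}\llbracket z\rrbracket[\vartheta]$ act on $\mathbb{C}\llbracket z\rrbracket[\ln z]$ with $\vartheta(\ln z)=1$, and functions appearing in a product of operators act by multiplication. Property (M): there is $r\in\mathbb{Z}$ such that the indicial equation of $L$ at $z=0$ is $(T-r)^{n+1}$ (here $r=0$). Property (P): there is $0\ne\alpha\in\mathbb{C}(z)$ with $L\alpha=\alpha L^\vee$ in $\mathbb{C}(z)[\partial]$, where $L^\vee=\sum_{i=0}^{n+1}(-1)^{n+1+i}\partial^ia_i$, $a_{n+1}:=1$. Flag: a basis $y_0,\dots,y_n$ of the solution space of $L$ near $z=0$ is a flag if there are $f_0,\dots,f_n\in\mathbb{C}\llbracket z\rrbracket$ with $f_0\in1+z\mathbb{C}\llbracket z\rrbracket$ (in the case $r=0$)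 such that $y_k=\sum_{j=0}^k\frac{1}{j!}\ln(z)^jf_{k-j}$ for $0\le k\le n$. *)

(* Defs.v *)
From HB Require Import structures.
From mathcomp Require Import all_boot all_order all_algebra.
From mathcomp Require Import ring boolp reals.
From mathcomp.real_closed Require Import complex.

Set Implicit Arguments.
Unset Strict Implicit.
Unset Printing Implicit Defensive.

Import GRing.Theory Num.Theory.
Local Open Scope ring_scope.

Record fps (K : Type) := Fps { fps_coef :> nat -> K }.

Notation "{ 'fps' K }" := (fps K) (format "{ 'fps'  K }") : type_scope.

HB.instance Definition _ (K : Type) := gen_eqMixin {fps K}.
HB.instance Definition _ (K : Type) := gen_choiceMixin {fps K}.

Lemma fpsP (K : Type) (f g : {fps K}) : (forall n, f n = g n) <-> f = g.
Proof.
split=> [|-> //]; case: f g => [f] [g] /= fg; congr Fps.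
exact: functional_extensionality_dep.
Qed.

Section FpsRing.
Variable K : fieldType.
Implicit Types f g h : {fps K}.

Definition fpsC (c : K) : {fps K} := Fps (fun n => if n == 0%N then c else 0).
Definition fpsX : {fps K} := Fps (fun n => (n == 1%N)%:R).
Definition fps_of_poly (p : {poly K}) : {fps K} := Fps (fun n => p`_n).

Definition fps_add f g : {fps K} := Fps (fun n => f n + g n).
Definition fps_opp f : {fps K} := Fps (fun n => - f n).
Definition fps_mul f g : {fps K} :=
  Fps (fun n => \sum_(i < n.+1) f i * g (n - i)%N).

Lemma fps_addA : associative fps_add.
Proof. by move=> f g h; apply/fpsP => n /=; rewrite addrA. Qed.

Lemma fps_addC : commutative fps_add.
Proof. by move=> f g; apply/fpsP => n /=; rewrite addrC. Qed.

Lemma fps_add0 : left_id (fpsC 0) fps_add.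
Proof. by move=> f; apply/fpsP => n /=; rewrite if_same add0r. Qed.

Lemma fps_addN : left_inverse (fpsC 0) fps_opp fps_add.
Proof. by move=> f; apply/fpsP => n /=; rewrite if_same addNr. Qed.

HB.instance Definition _ :=
  GRing.isZmodule.Build {fps K} fps_addA fps_addC fps_add0 fps_addN.

Definition fps_trunc n f : {poly K} := \poly_(i < n) f i.

Lemma fps_truncM n f g m : (m < n)%N ->
  (fps_trunc n f * fps_trunc n g)`_m = fps_mul f g m.
Proof.
move=> mn; rewrite coefM /=; apply: eq_bigr => i _; rewrite !coef_poly.
by rewrite (leq_ltn_trans _ mn) ?(leq_ltn_trans (leq_subr _ _) mn) // -ltnS.
Qed.

Lemma fps_mulC : commutative fps_mul.
Proof.
move=> f g; apply/fpsP => n.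
by rewrite -!(fps_truncM _ _ (ltnSn n)) mulrC.
Qed.

Lemma fps_mulA : associative fps_mul.
Proof.
move=> f g h; apply/fpsP => n; set t := fps_trunc n.+1.
transitivity ((t f * (t g * t h))`_n).
  rewrite coefM; apply: eq_bigr => i _.
  by rewrite fps_truncM ?coef_poly ?ltn_ord // ltnS leq_subr.
rewrite mulrA coefM; apply: eq_bigr => i _.
by rewrite fps_truncM ?coef_poly ?ltnS ?leq_subr // -ltnS ltn_ord.
Qed.

Lemma fps_mul1 : left_id (fpsC 1) fps_mul.
Proof.
move=> f; apply/fpsP => n /=; rewrite big_ord_recl /= subn0 mul1r.
by rewrite big1 ?addr0 // => i _; rewrite mul0r.
Qed.

Lemma fps_mulDl : left_distributive fps_mul fps_add.
Proof.
move=> f g h; apply/fpsP => n /=; rewrite -big_split /=.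
by apply: eq_bigr => i _; rewrite mulrDl.
Qed.

Lemma fps_oner_neq0 : fpsC 1 != 0.
Proof.
by apply/eqP => /fpsP /(_ 0%N) /= /eqP; rewrite oner_eq0.
Qed.

HB.instance Definition _ := GRing.Zmodule_isComNzRing.Build {fps K}
  fps_mulA fps_mulC fps_mul1 fps_mulDl fps_oner_neq0.

Lemma fps_coef0 n : (0 : {fps K}) n = 0.
Proof. by rewrite /= if_same. Qed.

Lemma fps_coef1 n : (1 : {fps K}) n = (n == 0%N)%:R.
Proof. by rewrite /=; case: eqP. Qed.

Lemma fps_coefD f g n : (f + g) n = f n + g n.
Proof. by []. Qed.

Lemma fps_coefN f n : (- f) n = - f n.
Proof. by []. Qed.

Lemma fps_coefM f g n : (f * g) n = \sum_(i < n.+1) f i * g (n - i)%N.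
Proof. by []. Qed.

Lemma fps_coef_sum (I : Type) (r : seq I) (P : pred I) (F : I -> {fps K}) n :
  (\sum_(i <- r | P i) F i) n = \sum_(i <- r | P i) (F i) n.
Proof.
by elim/big_rec2: _ => [|i y x _ <-]; rewrite ?fps_coef0 ?fps_coefD.
Qed.

Lemma fps_coefCM c f n : (fpsC c * f) n = c * f n.
Proof.
rewrite fps_coefM big_ord_recl /= subn0 big1 ?addr0 // => i _.
by rewrite mul0r.
Qed.

Lemma fps_coef0M f g : (f * g) 0%N = f 0%N * g 0%N.
Proof. by rewrite fps_coefM big_ord1. Qed.

Lemma fps_coefX_small f k n : f 0%N = 0 -> (n < k)%N -> (f ^+ k) n = 0.
Proof.
move=> f0; elim: k n => // k IHk n; rewrite ltnS => nk.
rewrite exprS fps_coefM big_ord_recl /= f0 mul0r add0r big1 // => i _.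
rewrite IHk ?mulr0 //= /bump leq0n add1n.
by case: n nk i => [|n] nk [i //= lin]; rewrite subSS (leq_ltn_trans (leq_subr _ _)).
Qed.

(* Geometric series: 1/f = f(0)^-1 * \sum_k (1 - f / f(0))^k when f(0) != 0. *)
Definition fps_unit : pred {fps K} := fun f => f 0%N != 0.
Definition fps_inv f : {fps K} :=
  if fps_unit f then
    Fps (fun n => (f 0%N)^-1 *
                  (\sum_(k < n.+1) (1 - fpsC (f 0%N)^-1 * f) ^+ k) n)
  else f.

Lemma fps_mulV : {in fps_unit, left_inverse 1 fps_inv *%R}.
Proof.
move=> f; rewrite /in_mem /= => fu; rewrite mulrC; apply/fpsP => n.
rewrite fps_coefM /fps_inv fu /=; set c := (f 0%N)^-1; set u := 1 - _.
have u0 : u 0%N = 0.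
  by rewrite fps_coefD fps_coefN fps_coef1 fps_coefCM /= mulVf ?subrr.
have cf : fpsC c * f = 1 - u by rewrite opprB addrC subrK.
pose S := \sum_(k < n.+1) u ^+ k.
transitivity ((fpsC c * f * S) n).
  rewrite mulrC mulrA mulrC fps_coefM; apply: eq_bigr => i _; congr (_ * _).
  rewrite mulrC fps_coefCM; congr (_ * _); rewrite !fps_coef_sum.
  rewrite (big_ord_widen n.+1 (fun k => (u ^+ k) (n - i)%N)) ?ltnS ?leq_subr //.
  rewrite big_mkcond; apply: eq_bigr => k _; case: ltnP => // ?.
  by rewrite fps_coefX_small.
rewrite cf -opprB mulNr -subrX1 opprB fps_coefD fps_coefN fps_coefX_small //.
by rewrite subr0.
Qed.

Lemma fps_unitPl f g : g * f = 1 -> fps_unit f.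
Proof.
move=> /(congr1 (fun h : {fps K} => h 0%N)); rewrite fps_coef0M fps_coef1 /=.
move=> gf; apply/eqP => f0; move/eqP: gf.
by rewrite f0 mulr0 eq_sym oner_eq0.
Qed.

Lemma fps_inv_out : {in [predC fps_unit], fps_inv =1 id}.
Proof. by move=> f; rewrite inE /in_mem /= /fps_inv => /negbTE ->. Qed.

HB.instance Definition _ := GRing.ComNzRing_hasMulInverse.Build {fps K}
  fps_mulV fps_unitPl fps_inv_out.

Lemma fps_unitE f : (f \is a GRing.unit) = (f 0%N != 0).
Proof. by []. Qed.

Lemma fps_neq0P f : f != 0 -> exists2 n, f n != 0 & forall m, (m < n)%N -> f m = 0.
Proof.
move=> f0; have ex : exists n, f n != 0.
  apply: contrapT => nex; move/eqP: f0; apply; apply/fpsP => n.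
  rewrite fps_coef0; apply/eqP; apply: contrapT => /negP fn.
  by apply: nex; exists n.
case: (ex_minnP ex) => n fn min; exists n => // m mn; apply/eqP.
by apply: contraLR mn => /min; rewrite leqNgt.
Qed.

Lemma fps_mulf_eq0 f g : f * g = 0 -> (f == 0) || (g == 0).
Proof.
move=> fg; apply/negP => /negP; rewrite negb_or => /andP[].
move=> /fps_neq0P[m fm ltm] /fps_neq0P[n gn ltn].
have /eqP := congr1 (fun h : {fps K} => h (m + n)%N) fg.
have mlt : (m < (m + n).+1)%N by rewrite ltnS leq_addr.
rewrite fps_coef0 fps_coefM (bigD1 (Ordinal mlt)) //= addKn big1 ?addr0.
  by rewrite mulf_eq0 (negbTE fm) (negbTE gn).
move=> i /eqP ne; case: (ltngtP i m) => im.
- by rewrite ltm ?mul0r.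
- rewrite [g _]ltn ?mulr0 // ltn_subLR ?ltn_add2r //.
  by rewrite -ltnS ltn_ord.
- by case: ne; apply: val_inj.
Qed.

HB.instance Definition _ :=
  GRing.ComUnitRing_isIntegral.Build {fps K} fps_mulf_eq0.

(* d/dz *)
Definition fps_deriv f : {fps K} := Fps (fun n => f n.+1 *+ n.+1).

Lemma fps_derivM f g :
  fps_deriv (f * g) = fps_deriv f * g + f * fps_deriv g.
Proof.
apply/fpsP => n; rewrite fps_coefD !fps_coefM /= -sumrMnl.
rewrite (eq_bigr (fun i : 'I_n.+2 =>
  (f i *+ i) * g (n.+1 - i)%N + f i * (g (n.+1 - i)%N *+ (n.+1 - i)))).
  rewrite big_split /=; congr (_ + _).
    rewrite big_ord_recl mulr0n mul0r add0r.
    by apply: eq_bigr => i _; rewrite /= /bump add1n subSS.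
  rewrite big_ord_recr /= subnn mulr0n mulr0 addr0.
  by apply: eq_bigr => i _; rewrite /= subSn // -ltnS.
move=> i _; rewrite mulrnAl mulrnAr -mulrnDr subnKC //.
by rewrite -ltnS.
Qed.

(* z d/dz *)
Definition fps_theta f : {fps K} := fpsX * fps_deriv f.

End FpsRing.

Definition fps_map (K K' : Type) (h : K -> K') (f : {fps K}) : {fps K'} :=
  Fps (fun n => h (f n)).

(* Quotient rule applied to the chosen representative of the fraction; by
   [frac_derE] the result does not depend on that choice. *)
Definition frac_der (A : idomainType) (d : A -> A) (x : {fraction A}) :
    {fraction A} :=
  let r := repr x in
  tofrac (d \n_r * \d_r - \n_r * d \d_r) / tofrac (\d_r ^+ 2).

Definition frac_map (A B : idomainType) (h : A -> B) (x : {fraction A}) :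
    {fraction B} :=
  let r := repr x in tofrac (h \n_r) / tofrac (h \d_r).

Lemma frac_repr (A : idomainType) (x : {fraction A}) :
  x = tofrac \n_(repr x) / tofrac \d_(repr x).
Proof.
rewrite -[LHS]reprK; case: (repr x) => [[n d] /= d0].
set X := \pi_({fraction A})%qT _.
suff : X * tofrac d = tofrac n by move=> <-; rewrite mulfK ?tofrac_eq0.
rewrite /X; unlock FracField.tofrac; rewrite -[LHS]FracField.pi_mul.
apply/eqmodP; rewrite /= FracField.equivfE /FracField.mulf /=.
by rewrite !numden_Ratio ?mulr1 ?oner_neq0 // mulrC.
Qed.

Lemma frac_eq (A : idomainType) (a b a' b' : A) : b != 0 -> b' != 0 ->
  (tofrac a / tofrac b == tofrac a' / tofrac b') = (a * b' == a' * b).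
Proof.
by move=> b0 b'0; rewrite eqr_div ?tofrac_eq0 // -!tofracM tofrac_eq.
Qed.

Lemma frac_derE (A : idomainType) (d : A -> A) (a b : A) :
    (forall u v, d (u * v) = d u * v + u * d v) -> b != 0 ->
  frac_der d (tofrac a / tofrac b) =
  tofrac (d a * b - a * d b) / tofrac (b ^+ 2).
Proof.
move=> dM b0; rewrite /frac_der; set x := (X in repr X).
have := frac_repr x; case: (repr x) => [[p q] /= q0] /eqP.
rewrite /x frac_eq // => /eqP e; have /eqP := congr1 d e.
rewrite !dM -subr_eq0 => /eqP de; apply/eqP; rewrite frac_eq ?expf_neq0 //.
move/eqP: e; rewrite -subr_eq0 => /eqP e; rewrite -subr_eq0; apply/eqP.
transitivity ((a * q - p * b) * (b * d q + q * d b)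
  - (d a * q + a * d q - (d p * b + p * d b)) * (q * b)); first by ring.
by rewrite e de !mul0r subr0.
Qed.

Lemma frac_mapE (A B : idomainType) (h : {rmorphism A -> B}) (a b : A) :
    injective h -> b != 0 ->
  frac_map h (tofrac a / tofrac b) = tofrac (h a) / tofrac (h b).
Proof.
move=> hI b0; rewrite /frac_map; set x := (X in repr X).
have := frac_repr x; case: (repr x) => [[p q] /= q0] /eqP.
have h0 u : u != 0 -> h u != 0 by rewrite -(inj_eq hI) rmorph0.
rewrite /x frac_eq // => /eqP e; apply/eqP.
by rewrite frac_eq ?h0 // -!rmorphM e.
Qed.

Notation ratfun K := {fraction {poly K}}.
Notation laurent K := {fraction {fps K}}.

(* d/dz on K(z) and on K((z)) *)
Definition ratfun_deriv (K : fieldType) : ratfun K -> ratfun K :=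
  frac_der (@deriv K).
Definition laurent_deriv (K : fieldType) : laurent K -> laurent K :=
  frac_der (@fps_deriv K).

(* K(z) -> K'(z) induced by K -> K' *)
Definition ratfun_map (K K' : fieldType) (h : K -> K') :
    ratfun K -> ratfun K' :=
  frac_map (map_poly h).

(* expansion at z = 0, K(z) -> K((z)) *)
Definition laurent_of_ratfun (K : fieldType) : ratfun K -> laurent K :=
  frac_map (@fps_of_poly K).

(* An operator \sum_i a_i D^i over a ring A with derivation d is encoded by the
   polynomial \sum_i a_i 'X^i; only the additive structure of {poly A} is
   meaningful for operators, products being given by [ore_mul] below, where
   D a = a D + d a. *)

Definition ore_act (A : nzRingType) (M : lmodType A) (delta : M -> M)
    (P : {poly A}) (y : M) : M :=
  \sum_(i < size P) P`_i *: iter i delta y.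

(* D \sum_j q_j D^j = \sum_j (d q_j) D^j + \sum_j q_j D^(j+1) *)
Definition ore_lmulD (A : nzRingType) (d : A -> A) (Q : {poly A}) : {poly A} :=
  map_poly d Q + Q * 'X.

Definition ore_mul (A : nzRingType) (d : A -> A) (P Q : {poly A}) : {poly A} :=
  ore_act (ore_lmulD d) P Q.

Lemma ore_act_widen (A : nzRingType) (M : lmodType A) (delta : M -> M) m
    (P : {poly A}) y : (size P <= m)%N ->
  ore_act delta P y = \sum_(i < m) P`_i *: iter i delta y.
Proof.
move=> Pm; rewrite /ore_act (big_ord_widen m (fun i => P`_i *: iter i delta y)) //.
rewrite big_mkcond; apply: eq_bigr => i _; case: ltnP => // Pi.
by rewrite nth_default ?scale0r.
Qed.

Lemma ore_act_mul (A : nzRingType) (M : lmodType A) (d : {additive A -> A})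
    (delta : {additive M -> M}) (P Q : {poly A}) (y : M) :
    (forall a m, delta (a *: m) = d a *: m + a *: delta m) ->
  ore_act delta (ore_mul d P Q) y = ore_act delta P (ore_act delta Q y).
Proof.
move=> leib.
pose W m P1 := @ore_act_widen _ _ delta m P1 y.
have actD P1 P2 : ore_act delta (P1 + P2) y =
    ore_act delta P1 y + ore_act delta P2 y.
  set m := maxn (size P1) (size P2).
  rewrite (W m) ?size_polyD // (W m P1) ?leq_maxl // (W m P2) ?leq_maxr //.
  by rewrite -big_split; apply: eq_bigr => i _; rewrite coefD scalerDl.
have actZ a P1 : ore_act delta (a *: P1) y = a *: ore_act delta P1 y.
  rewrite (W (size P1)) ?size_scale_leq // scaler_sumr.
  by apply: eq_bigr => i _; rewrite coefZ scalerA.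
have act0 : ore_act delta 0 y = 0.
  by rewrite /ore_act size_poly0 big_ord0.
have actX Q1 : ore_act delta (ore_lmulD d Q1) y = delta (ore_act delta Q1 y).
  rewrite actD (W (size Q1)) ?size_poly // (W (size Q1).+1 (Q1 * 'X)).
    rewrite big_ord_recl coefMX eqxx scale0r add0r -big_split raddf_sum.
    by apply: eq_bigr => i _ /=; rewrite coefMX coef_map_id0 ?raddf0 // leib.
  by rewrite (leq_trans (size_polyMleq _ _)) // size_polyX addn2.
rewrite /ore_mul {1 3}/ore_act.
apply: (big_ind2 (fun T v => ore_act delta T y = v)) => // [U u V v <- <-|i _].
  exact: actD.
by rewrite actZ; congr (_ *: _); elim: (nat_of_ord i) => //= k <-; rewrite actX.
Qed.

(* irreducibility in A[D], for A a field *)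
Definition ore_irreducible (A : fieldType) (d : A -> A) (L : {poly A}) : Prop :=
  (1 < size L)%N /\
  forall P Q : {poly A}, ore_mul d P Q = L -> size P = 1%N \/ size Q = 1%N.

Definition regular_at0 (K : fieldType) (x : ratfun K) (c : K) : Prop :=
  exists p q : {poly K},
    [/\ q.[0] != 0, x = tofrac p / tofrac q & c = p.[0] / q.[0]].

(* T (T - 1) ... (T - i + 1) *)
Definition falling_poly (K : fieldType) (i : nat) : {poly K} :=
  \prod_(j < i) ('X - j%:R%:P).

(* I is the indicial polynomial of L at z = 0: for some m,
   L z^T = z^(T - m) (I(T) + O(z)) with I != 0, where
   (\sum_i a_i d^i) z^T = z^(T - m) \sum_i (z^(m - i) a_i) T (T-1) ... (T-i+1). *)
Definition indicial_poly (K : fieldType) (L : {poly ratfun K})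
    (I : {poly K}) : Prop :=
  exists (m : int) (c : nat -> K),
    [/\ forall i, (i < size L)%N ->
          regular_at0 (tofrac 'X ^ (m - i%:Z) * L`_i) (c i),
        exists2 i, (i < size L)%N & c i != 0
      & I = \sum_(i < size L) c i *: falling_poly K i].

Definition is_exponent (K : fieldType) (L : {poly ratfun K}) (e : K) : Prop :=
  exists2 I, indicial_poly L I & root I e.

Definition property_M (K : fieldType) (n : nat) (L : {poly ratfun K}) : Prop :=
  exists r : int, indicial_poly L (('X - r%:~R%:P) ^+ n.+1).

(* L^\vee, for L monic of order n + 1 *)
Definition adjoint_op (K : fieldType) (n : nat) (L : {poly ratfun K}) :
    {poly ratfun K} :=
  \sum_(i < n.+2)
    (-1) ^+ (n.+1 + i) *: ore_mul (@ratfun_deriv K) 'X^i (L`_i)%:P.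

Definition property_P (K : fieldType) (n : nat) (L : {poly ratfun K}) : Prop :=
  exists2 alpha : ratfun K, alpha != 0 &
    ore_mul (@ratfun_deriv K) L alpha%:P =
    ore_mul (@ratfun_deriv K) alpha%:P (adjoint_op n L).

(* {poly {fps K}} is K[[z]][ln z] and {poly laurent K} is K((z))[ln z], with 'X
   standing for ln z. *)

Definition log_theta (K : fieldType) (y : {poly {fps K}}) : {poly {fps K}} :=
  map_poly (@fps_theta K) y + y^`().

Definition log_deriv (K : fieldType) (y : {poly laurent K}) :
    {poly laurent K} :=
  map_poly (@laurent_deriv K) y + (tofrac (fpsX K))^-1 *: y^`().

Definition is_solution (K : fieldType) (L : {poly ratfun K})
    (y : {poly {fps K}}) : Prop :=
  ore_act (@log_deriv K) (map_poly (@laurent_of_ratfun K) L)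
    (map_poly (@FracField.tofrac {fps K}) y) = 0.

Definition solution_basis (K : fieldType) (n : nat) (L : {poly ratfun K})
    (y : nat -> {poly {fps K}}) : Prop :=
  [/\ forall i, (i <= n)%N -> is_solution L (y i),
      forall c : 'I_n.+1 -> K,
        \sum_(i < n.+1) fpsC (c i) *: y i = 0 -> forall i, c i = 0
    & forall u, is_solution L u ->
        exists c : 'I_n.+1 -> K, u = \sum_(i < n.+1) fpsC (c i) *: y i].

Definition flag (K : fieldType) (n : nat) (L : {poly ratfun K})
    (y : nat -> {poly {fps K}}) : Prop :=
  solution_basis n L y /\
  exists f : nat -> {fps K},
    f 0%N 0%N = 1 /\
    forall k, (k <= n)%N ->
      y k = \sum_(j < k.+1) (fpsC (j`!%:R^-1) * f (k - j)%N) *: 'X^j.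

(* Elements of K[[z]][theta] acting on K[[z]][ln z] *)
Definition theta_act (K : fieldType) (P : {poly {fps K}})
    (y : {poly {fps K}}) : {poly {fps K}} :=
  ore_act (@log_theta K) P y.

(* The factor 1 / N_k(y_k) is formed from the ln-free coefficient of N_k(y_k);
   it is the intended one as soon as N_k(y_k) is a unit of K[[z]]. *)
Fixpoint Nop (K : fieldType) (y : nat -> {poly {fps K}}) (k : nat) :
    {poly {fps K}} :=
  if k is k'.+1 then
    let N := Nop y k' in
    ore_mul (@fps_theta K) 'X
      (ore_mul (@fps_theta K) (((theta_act N (y k'))`_0)^-1)%:P N)
  else 1.

(* L in Q(z)[d] seen in C(z)[d] *)
Definition complexify (R : realType) (L : {poly ratfun rat}) :
    {poly ratfun R[i]} :=
  map_poly (ratfun_map (ratr : rat -> R[i])) L.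

(* Main.v *)
Require Import Defs.
From HB Require Import structures.
From mathcomp Require Import all_boot all_order all_algebra.
From mathcomp Require Import ring boolp reals.
From mathcomp.real_closed Require Import complex.

(* If (y_i) is a flag with series f, then theta (y_{i+1} / y_0) is again a flag,
   with series theta (f_{i+1} / f_0) + f_i / f_0, whose first member still has
   constant term 1; so each N_k (y_k) is a unit, and N_{k+1} kills y_k.

   For rationality, N_j depends on the flag only up to the change of basis
   y_k |-> \sum_s d_s y_{k-s} with d_0 = 1.  Taking \sum_s d_s t^s inverse to
   \sum_k f_k(0) t^k makes the z^0 part of y_k equal to ln(z)^k / k!.  After
   multiplication by a power of z, L becomes \sum_i b_i theta (theta - 1) ...
   (theta - i + 1) with b_i in Q[[z]], and by property (M) its z^0 part is
   theta^{n+1}.  Hence the coefficient of z^m ln(z)^j in a solution is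
   m^{-(n+1)} times a rational expression in the coefficients of lower powers
   of z, or of z^m and higher powers of ln(z), so that the normalised flag, and
   with it N_j, is rational. *)

Set Implicit Arguments.
Unset Strict Implicit.
Unset Printing Implicit Defensive.

Import GRing.Theory Num.Theory.
Local Open Scope ring_scope.

(** * The derivation theta on K[[z]][ln z], flags, and the operators N_k *)

Section LogTheta.
Variable K : fieldType.
Implicit Types (c : K) (f g : {fps K}) (y : {poly {fps K}}).

Lemma fps_coefMn f k m : (f *+ k) m = f m *+ k.
Proof.
by elim: k => [|k IH]; rewrite ?mulr0n ?fps_coef0 // !mulrSr fps_coefD IH.
Qed.

Lemma fps_theta_coef f m : fps_theta f m = f m *+ m.
Proof.
rewrite /fps_theta fps_coefM; case: m => [|m].
  by rewrite big_ord1 mul0r mulr0n.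
rewrite (bigD1 (Ordinal (isT : (1 < m.+2)%N))) //= mul1r subSS subn0.
rewrite big1 ?addr0 // => -[[|[|i]] ?] //=; by rewrite mul0r.
Qed.

Lemma fps_theta_is_zmod_morphism : zmod_morphism (@fps_theta K).
Proof.
move=> f g; apply/fpsP => m.
by rewrite !(fps_theta_coef, fps_coefD, fps_coefN) mulrnBl.
Qed.

HB.instance Definition _ := GRing.isZmodMorphism.Build {fps K} {fps K}
  (@fps_theta K) fps_theta_is_zmod_morphism.

Lemma fps_thetaM f g : fps_theta (f * g) = fps_theta f * g + f * fps_theta g.
Proof. by rewrite /fps_theta fps_derivM mulrDr !mulrA [f * fpsX K]mulrC. Qed.

Lemma fps_thetaC c : fps_theta (fpsC c) = 0.
Proof.
by apply/fpsP => -[|m]; rewrite fps_theta_coef fps_coef0 ?mulr0n //= mul0rn.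
Qed.

Lemma coef_log_theta y j :
  (log_theta y)`_j = fps_theta y`_j + y`_j.+1 *+ j.+1.
Proof. by rewrite coefD coef_map coef_deriv. Qed.

Lemma log_thetaC c : log_theta (fpsC c)%:P = 0.
Proof.
by apply/polyP => -[|j];
  rewrite coef_log_theta !coefC /= mul0rn addr0 fps_thetaC ?coef0.
Qed.

Lemma log_theta_is_zmod_morphism : zmod_morphism (@log_theta K).
Proof.
by move=> y z; rewrite /log_theta !raddfB /= opprD addrACA.
Qed.

HB.instance Definition _ := GRing.isZmodMorphism.Build {poly {fps K}}
  {poly {fps K}} (@log_theta K) log_theta_is_zmod_morphism.

Lemma log_thetaZ f y :
  log_theta (f *: y) = fps_theta f *: y + f *: log_theta y.
Proof.
apply/polyP => j.
rewrite coef_log_theta [RHS]coefD !coefZ coef_log_theta fps_thetaM.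
by rewrite mulrDr addrA mulrnAr.
Qed.

Lemma log_thetaZC c y : log_theta (fpsC c *: y) = fpsC c *: log_theta y.
Proof. by rewrite log_thetaZ fps_thetaC scale0r add0r. Qed.

Lemma theta_actM (P Q : {poly {fps K}}) y :
  theta_act (ore_mul (@fps_theta K) P Q) y = theta_act P (theta_act Q y).
Proof. exact: ore_act_mul log_thetaZ. Qed.

Lemma theta_actC f y : theta_act f%:P y = f *: y.
Proof.
rewrite /theta_act (@ore_act_widen _ _ _ 1) ?size_polyC ?leq_b1 //.
by rewrite big_ord1 coefC eqxx.
Qed.

Lemma theta_actX y : theta_act 'X y = log_theta y.
Proof.
rewrite /theta_act (@ore_act_widen _ _ _ 2) ?size_polyX //.
by rewrite big_ord_recl big_ord1 !coefX scale0r add0r scale1r.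
Qed.

Lemma theta_act_is_zmod_morphism (P : {poly {fps K}}) :
  zmod_morphism (theta_act P).
Proof.
move=> y z; rewrite /theta_act /ore_act -sumrB; apply: eq_bigr => i _.
rewrite -scalerBr; congr (_ *: _).
by elim: (nat_of_ord i) => //= k ->; rewrite raddfB.
Qed.

HB.instance Definition _ P := GRing.isZmodMorphism.Build {poly {fps K}}
  {poly {fps K}} (theta_act P) (theta_act_is_zmod_morphism P).

Lemma theta_actZC (P : {poly {fps K}}) c y :
  theta_act P (fpsC c *: y) = fpsC c *: theta_act P y.
Proof.
rewrite /theta_act /ore_act scaler_sumr; apply: eq_bigr => i _.
rewrite scalerA [fpsC c * _]mulrC -scalerA; congr (_ *: _).
by elim: (nat_of_ord i) => //= k ->; rewrite log_thetaZC.
Qed.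

Lemma theta_act_NopS (y : nat -> {poly {fps K}}) k z :
  theta_act (Nop y k.+1) z =
  log_theta (((theta_act (Nop y k) (y k))`_0)^-1 *: theta_act (Nop y k) z).
Proof. by rewrite /= !theta_actM theta_actX theta_actC. Qed.

(** The shape of a flag member for an arbitrary sequence [f], so that operators on flags become
    operations on [f]. *)
Definition flag_poly (f : nat -> {fps K}) (k : nat) : {poly {fps K}} :=
  \sum_(j < k.+1) (fpsC (j`!%:R^-1) * f (k - j)%N) *: 'X^j.

Lemma coef_flag_poly (f : nat -> {fps K}) k j : (flag_poly f k)`_j =
  if (j <= k)%N then fpsC (j`!%:R^-1) * f (k - j)%N else 0.
Proof.
have -> : flag_poly f k =
    \poly_(l < k.+1) (fpsC (l`!%:R^-1) * f (k - l)%N).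
  by rewrite poly_def.
by rewrite coef_poly. Qed.

Lemma flag_poly0 (f : nat -> {fps K}) : flag_poly f 0 = (f 0%N)%:P.
Proof.
by rewrite /flag_poly big_ord1 expr0 fact0 invr1 mul1r alg_polyC.
Qed.

Lemma flag_polyZ g (f : nat -> {fps K}) k :
  g *: flag_poly f k = flag_poly (fun i => g * f i) k.
Proof.
rewrite scaler_sumr; apply: eq_bigr => j _.
by rewrite scalerA mulrCA.
Qed.

(** A vanishing first series removes the top power of ln z; this occurs once theta has killed a
    first member equal to 1. *)
Lemma flag_poly_shift (f : nat -> {fps K}) k :
  f 0%N = 0 -> flag_poly f k.+1 = flag_poly (fun i => f i.+1) k.
Proof.
move=> f0; apply/polyP => j; rewrite !coef_flag_poly.
case: (ltngtP j k.+1) => [jk|kj|->].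
- by rewrite -ltnS jk subSn.
- by rewrite leqNgt (ltn_trans _ kj).
- by rewrite subnn f0 mulr0 ltnn.
Qed.

Hypothesis charK : forall m, m.+1%:R != 0 :> K.

(** Since theta sends ln(z)^j / j! to ln(z)^(j-1) / (j-1)!, it acts on the sequence of series as
    [fps_theta] plus a shift of the index. *)
Lemma log_theta_flag (f : nat -> {fps K}) k :
  log_theta (flag_poly f k) =
  flag_poly (fun i => fps_theta (f i) + (if i is i'.+1 then f i' else 0)) k.
Proof.
have factV j : fpsC (j.+1`!%:R^-1) *+ j.+1 = fpsC (j`!%:R^-1) :> {fps K}.
  apply/fpsP => m; rewrite fps_coefMn /=; case: eqP => _; last by rewrite mul0rn.
  by rewrite factS natrM invfM -[LHS]mulr_natl mulrA mulfV ?mul1r.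
apply/polyP => j; rewrite coef_log_theta !coef_flag_poly.
case: (ltngtP j k) => jk.
- rewrite fps_thetaM fps_thetaC mul0r add0r mulrDr; congr (_ + _).
  rewrite -mulrnAl factV subnS.
  by case: (k - j)%N (subn_gt0 j k) => //; rewrite jk.
- by rewrite raddf0 mul0rn addr0.
- rewrite jk subnn fps_thetaM fps_thetaC mul0r add0r mul0rn.
  by rewrite !addr0.
Qed.

(** Induction on [k]: division by the first member makes it 1, theta kills it, and the later members
    move down one place. The new first series again has constant term 1, because values of
    [fps_theta] have constant term 0. *)
Lemma Nop_flag n (y : nat -> {poly {fps K}}) (f : nat -> {fps K}) :
    f 0%N 0%N = 1 -> (forall k, (k <= n)%N -> y k = flag_poly f k) ->
  forall k, exists2 g : nat -> {fps K}, g 0%N 0%N = 1 &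
    forall i, (k + i <= n)%N -> theta_act (Nop y k) (y (k + i)%N) = flag_poly g i.
Proof.
move=> f0 yf; elim=> [|k [g g0 IH]].
  by exists f => // i ltin; rewrite add0n theta_actC scale1r yf.
have gU : g 0%N \is a GRing.unit by rewrite fps_unitE g0 oner_eq0.
exists (fun i => fps_theta ((g 0%N)^-1 * g i.+1) + (g 0%N)^-1 * g i).
  by rewrite fps_coefD fps_theta_coef mulr0n add0r mulVr // fps_coef1.
move=> i lti; rewrite addSnnS theta_act_NopS.
have le : (k + 0 <= n)%N.
  by rewrite addn0; apply: leq_trans lti; rewrite addSn -addnS leq_addr.
have := IH 0%N le; rewrite addn0 => ->; rewrite flag_poly0 coefC /=.
rewrite IH -?addSnnS // flag_polyZ (log_theta_flag _ i.+1) flag_poly_shift //.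
by rewrite mulVr // fps_thetaC addr0.
Qed.

Section Flag.
Variables (n : nat) (y : nat -> {poly {fps K}}) (f : nat -> {fps K}).
Hypothesis f0 : f 0%N 0%N = 1.
Hypothesis yf : forall k, (k <= n)%N -> y k = flag_poly f k.

Lemma Nop_flag_unit k : (k <= n)%N ->
  exists2 u : {fps K}, u \is a GRing.unit & theta_act (Nop y k) (y k) = u%:P.
Proof.
move=> kn; have [g g0] := Nop_flag f0 yf k.
move=> /(_ 0%N); rewrite addn0 flag_poly0 => /(_ kn) ->.
by exists (g 0%N) => //; rewrite fps_unitE g0 oner_eq0.
Qed.

(** At [i = j - 1] the division gives 1, which theta kills; a member killed earlier stays killed by
    the later factors. *)
Lemma Nop_flag_eq0 j i : (j <= n.+1)%N -> (i < j)%N ->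
  theta_act (Nop y j) (y i) = 0.
Proof.
elim: j => // j IH jn; rewrite theta_act_NopS ltnS leq_eqVlt => /orP[/eqP->|ij].
  have [u uU ->] := Nop_flag_unit jn.
  rewrite coefC /= -mul_polyC -polyCM mulVr //.
  exact: log_thetaC.
by rewrite IH ?scaler0 ?raddf0 // ltnW.
Qed.

End Flag.
End LogTheta.

(** * Series with coefficients in a subfield S, and linear equations in theta over S *)

Section Over.
Variables (K : fieldType) (S : divringClosed K).
Implicit Types (f g : {fps K}) (y : {poly {fps K}}).

Definition fpsOver : {pred {fps K}} :=
  [pred f : {fps K} | `[< forall m, f m \in S >]].

Lemma fpsOverP f : reflect (forall m, f m \in S) (f \in fpsOver).
Proof. exact: asboolP. Qed.

Lemma fpsOver_subring : subring_closed fpsOver.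
Proof.
split=> [|f g|f g].
- by apply/fpsOverP => m; rewrite fps_coef1 rpred_nat.
- move=> /fpsOverP fS /fpsOverP gS; apply/fpsOverP => m.
  by rewrite fps_coefD fps_coefN rpredB.
- move=> /fpsOverP fS /fpsOverP gS; apply/fpsOverP => m.
  by rewrite fps_coefM rpred_sum // => i _; rewrite rpredM.
Qed.

HB.instance Definition _ := GRing.isSubringClosed.Build {fps K} fpsOver
  fpsOver_subring.

Lemma fpsC_Over c : c \in S -> fpsC c \in fpsOver.
Proof. by move=> cS; apply/fpsOverP => m /=; case: ifP; rewrite ?rpred0. Qed.

(** A unit is inverted by the geometric series, whose terms stay over [S]; a non-unit is its own
    inverse by convention. *)
Lemma fpsOverV f : f \in fpsOver -> f^-1 \in fpsOver.
Proof.
move=> fS; rewrite /GRing.inv /= /fps_inv; case: ifP => // _.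
have cS : (f 0%N)^-1 \in S by rewrite rpredV; exact/fpsOverP.
apply/fpsOverP => m /=; rewrite rpredM //.
have /fpsOverP // : \sum_(k < m.+1) (1 - fpsC (f 0%N)^-1 * f) ^+ k \in fpsOver.
rewrite rpred_sum // => i _.
by rewrite rpredX // rpredB ?rpred1 ?rpredM ?fpsC_Over.
Qed.

Lemma fpsOver_theta f : f \in fpsOver -> fps_theta f \in fpsOver.
Proof.
move=> /fpsOverP fS; apply/fpsOverP => m.
by rewrite fps_theta_coef rpredMn.
Qed.

Lemma polyOver_log_theta y :
  y \in polyOver fpsOver -> log_theta y \in polyOver fpsOver.
Proof.
move=> /polyOverP yS; apply/polyOverP => j.
by rewrite coef_log_theta rpredD ?rpredMn ?fpsOver_theta.
Qed.

Lemma polyOver_ore_act (delta : {poly {fps K}} -> {poly {fps K}}) P y :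
    {in polyOver fpsOver, forall z, delta z \in polyOver fpsOver} ->
    P \in polyOver fpsOver -> y \in polyOver fpsOver ->
  ore_act delta P y \in polyOver fpsOver.
Proof.
move=> dS /polyOverP PS yS; rewrite /ore_act rpred_sum // => i _.
rewrite polyOverZ //; elim: (nat_of_ord i) => //= k; exact: dS.
Qed.

Lemma polyOver_ore_mul P Q :
    P \in polyOver fpsOver -> Q \in polyOver fpsOver ->
  ore_mul (@fps_theta K) P Q \in polyOver fpsOver.
Proof.
move=> PS QS; apply: polyOver_ore_act => // z zS.
rewrite rpredD ?rpredM ?polyOverX //.
by apply/polyOverP => j; rewrite coef_map fpsOver_theta //; apply/polyOverP: j.
Qed.

Lemma polyOver_Nop n (y : nat -> {poly {fps K}}) :
    (forall k, (k <= n)%N -> y k \in polyOver fpsOver) ->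
  forall j, (j <= n.+1)%N -> Nop y j \in polyOver fpsOver.
Proof.
move=> yS; elim=> [|j IH] jn; first exact: rpred1.
have NS := IH (ltnW jn).
rewrite !polyOver_ore_mul ?polyOverX // polyOverC fpsOverV //.
suff /polyOverP-> : theta_act (Nop y j) (y j) \in polyOver fpsOver by [].
by apply: polyOver_ore_act => //; [exact: polyOver_log_theta | exact: yS].
Qed.

(** With [v] the order of [g], the coefficient of z^(m+v) in [f * g] is [f m * g v] plus terms in
    earlier coefficients of [f], so [f m] is found by division by [g v]. *)
Lemma fpsOver_divr f g :
  g != 0 -> g \in fpsOver -> f * g \in fpsOver -> f \in fpsOver.
Proof.
move=> /fps_neq0P[v gv ltv] /fpsOverP gS /fpsOverP fgS; apply/fpsOverP.
elim/ltn_ind => m IH; have := fgS (m + v)%N.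
have lt_m : (m < (m + v).+1)%N by rewrite ltnS leq_addr.
rewrite fps_coefM (bigD1 (Ordinal lt_m)) //= addKn rpredDr.
  by move=> fgm; rewrite -(mulfK gv (f m)) rpred_div.
rewrite rpred_sum // => i /eqP ne; case: (ltngtP i m) => im.
- by rewrite rpredM ?IH.
- by rewrite ltv ?mulr0 ?rpred0 // ltn_subLR ?ltn_add2r // -ltnS ltn_ord.
- by case: ne; apply: val_inj.
Qed.

(** The product theta (theta - 1) ... (theta - i + 1), that is z^i d^i, applied to [y]. *)
Fixpoint theta_falling (i : nat) y : {poly {fps K}} :=
  if i is i'.+1 then log_theta (theta_falling i' y) - theta_falling i' y *+ i'
  else y.

Lemma coef_theta_fallingS i y j m :
  (theta_falling i.+1 y)`_j m =
  ((theta_falling i y)`_j m *+ m + (theta_falling i y)`_j.+1 m *+ j.+1)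
  - (theta_falling i y)`_j m *+ i.
Proof.
rewrite /= coefB coefMn coef_log_theta.
by rewrite fps_coefD fps_coefN fps_coefD !fps_coefMn fps_theta_coef.
Qed.

(** At a fixed power of z, the coefficient of ln(z)^j after theta involves only those of ln(z)^j and
    ln(z)^(j+1), so nothing below [j0] enters. *)
Lemma theta_falling_coef_over i y j0 m :
  (forall j, (j0 <= j)%N -> y`_j m \in S) ->
  forall j, (j0 <= j)%N -> (theta_falling i y)`_j m \in S.
Proof.
move=> yS; elim: i => // i IH j j0j; rewrite coef_theta_fallingS.
by rewrite rpredB ?rpredD ?rpredMn ?IH // (leq_trans j0j).
Qed.

(* Modulo higher powers of ln z, theta acts on z^m as multiplication by m. *)
Lemma theta_falling_coef_lead i y j m :
    (forall j', (j < j')%N -> y`_j' m \in S) ->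
  (theta_falling i y)`_j m - (falling_poly K i).[m%:R] * y`_j m \in S.
Proof.
move=> yS; elim: i => [|i IH].
  by rewrite /falling_poly big_ord0 hornerC mul1r subrr rpred0.
rewrite coef_theta_fallingS /falling_poly big_ord_recr /= hornerM hornerXsubC.
rewrite -/(falling_poly K i).
set a := (theta_falling i y)`_j m in IH *; set c := _.[_] in IH *.
set b := (theta_falling i y)`_j.+1 m.
have bS : b \in S by apply: (theta_falling_coef_over i (j0 := j.+1)).
have -> : a *+ m + b *+ j.+1 - a *+ i - c * (m%:R - i%:R) * y`_j m =
    (m%:R - i%:R) * (a - c * y`_j m) + b *+ j.+1.
  by rewrite -(mulr_natr a m) -(mulr_natr a i) -(mulr_natr b); ring.
by rewrite rpredD ?rpredM ?rpredMn // rpredB ?rpred_nat.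
Qed.

(** At z^(m+1) ln(z)^j the equation reads: indicial value at [m + 1] times the unknown coefficient,
    plus terms already in [S]. Hence induction upwards on the power of z, from the given z^0 part,
    and inside it downwards on the power of ln z. *)
Lemma theta_equation_over N (b : nat -> {fps K}) y :
    (forall i, (i < N)%N -> b i \in fpsOver) ->
    (forall m, \sum_(i < N) b i 0%N * (falling_poly K i).[m.+1%:R] != 0) ->
    \sum_(i < N) b i *: theta_falling i y = 0 ->
    (forall j, y`_j 0%N \in S) ->
  y \in polyOver fpsOver.
Proof.
move=> bS c0 eq0 y0; suff yS m : forall j, y`_j m \in S.
  by apply/polyOverP => j; apply/fpsOverP.
elim/ltn_ind: m => -[//|m] IH.
(* Downward induction on [j], run through [d]: for [d = 0] the index is at least [size y] and the
   coefficient vanishes. *)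
suff yS d : forall j, (size y <= j + d)%N -> y`_j m.+1 \in S.
  by move=> j; apply: (yS (size y)); rewrite leq_addl.
elim: d => [|d IHd] j szy.
  by rewrite addn0 in szy; rewrite nth_default // fps_coef0 rpred0.
have yS j' : (j < j')%N -> y`_j' m.+1 \in S.
  by move=> jj'; apply: IHd; rewrite (leq_trans szy) // addnS -addSn leq_add2r.
have := congr1 (fun z : {poly {fps K}} => z`_j m.+1) eq0.
rewrite coef_sum fps_coef_sum coef0 fps_coef0 => /eqP.
(* Three pieces: the unknown coefficient with its indicial factor, the contribution of higher powers
   of ln z at the same power of z, and that of lower powers of z. *)
rewrite (eq_bigr (fun i : 'I_N =>
    b i 0%N * (falling_poly K i).[m.+1%:R] * y`_j m.+1 +
    (b i 0%N * ((theta_falling i y)`_j m.+1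
        - (falling_poly K i).[m.+1%:R] * y`_j m.+1) +
     \sum_(s < m.+1) b i s.+1 * (theta_falling i y)`_j (m - s)%N))); last first.
  move=> i _; rewrite coefZ fps_coefM big_ord_recl /= subn0 addrA; congr (_ + _).
  by rewrite mulrBr mulrA addrC subrK.
rewrite big_split -mulr_suml /= addr_eq0 => /eqP e.
rewrite -[y`_j _](mulKf (c0 m)) e rpredM ?rpredV ?rpredN //.
  apply: rpred_sum => i _; rewrite rpredM //; first by apply/fpsOverP; apply: bS.
  rewrite /falling_poly rpred_horner ?rpred_nat //.
  by rewrite rpred_prod // => l _; rewrite polyOverXsubC rpred_nat.
apply: rpred_sum => i _; rewrite rpredD ?rpredM ?theta_falling_coef_lead //.
  by apply/fpsOverP; apply: bS.
rewrite rpred_sum // => s _; rewrite rpredM //.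
  by apply/fpsOverP; apply: bS.
apply: (theta_falling_coef_over i (j0 := 0)) => // j' _.
by apply: IH; rewrite ltnS leq_subr.
Qed.

End Over.

(** * Expansion of polynomials at 0, and d/dz expressed through theta *)

Section Expansion.
Variable K : fieldType.

Lemma fps_of_poly_is_zmod_morphism : zmod_morphism (@fps_of_poly K).
Proof. by move=> p q; apply/fpsP => m; rewrite /= coefB. Qed.

Lemma fps_of_poly_is_monoid_morphism : monoid_morphism (@fps_of_poly K).
Proof.
split=> [|p q]; apply/fpsP => m; first by rewrite fps_coef1 /= coef1.
by rewrite fps_coefM /= coefM.
Qed.

HB.instance Definition _ := GRing.isZmodMorphism.Build {poly K} {fps K}
  (@fps_of_poly K) fps_of_poly_is_zmod_morphism.
HB.instance Definition _ := GRing.isMonoidMorphism.Build {poly K} {fps K}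
  (@fps_of_poly K) fps_of_poly_is_monoid_morphism.

Lemma fps_of_poly_inj : injective (@fps_of_poly K).
Proof. by move=> p q /fpsP pq; apply/polyP => m; apply: pq. Qed.

Lemma fps_of_polyX : fps_of_poly 'X = fpsX K.
Proof. by apply/fpsP => m; rewrite /= coefX. Qed.

Lemma fpsX_neq0 : fpsX K != 0.
Proof.
rewrite -fps_of_polyX -(rmorph0 (@fps_of_poly K)).
by rewrite (inj_eq fps_of_poly_inj) polyX_eq0.
Qed.

(** This is theta z^i = i z^i; the factor z avoids the exponent [i - 1]. *)
Lemma fps_deriv_Xn i : fpsX K * fps_deriv (fpsX K ^+ i) = fpsX K ^+ i *+ i.
Proof.
rewrite -/(fps_theta _); elim: i => [|i IH].
  by rewrite expr0 mulr0n; exact: (fps_thetaC 1).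
rewrite exprS fps_thetaM IH (_ : fps_theta _ = fpsX K).
  by rewrite mulrnAr -exprS mulrS.
apply/fpsP => m; rewrite fps_theta_coef /=.
by case: eqP => [->|_]; rewrite ?mul0rn.
Qed.

Let z : laurent K := tofrac (fpsX K).

(** The factor theta - i is the next one in the falling product: this is the induction step for d^i
    = z^(-i) theta (theta - 1) ... (theta - i + 1). *)
Lemma laurent_deriv_div_Xn (f : {fps K}) i :
  laurent_deriv (z ^- i * tofrac f) = z ^- i.+1 * tofrac (fps_theta f - f *+ i).
Proof.
rewrite mulrC -tofracXn /laurent_deriv frac_derE; last 2 first.
- exact: fps_derivM.
- by rewrite expf_neq0 ?fpsX_neq0.
rewrite [RHS]mulrC -tofracXn; apply/eqP.
rewrite frac_eq ?expf_neq0 ?fpsX_neq0 //.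
apply/eqP; rewrite exprS; have := fps_deriv_Xn i.
rewrite /fps_theta -(mulr_natr f) -(mulr_natr (_ ^+ i)).
set X := fpsX K; set Y := X ^+ i; set Y' := fps_deriv Y => e.
transitivity (X * fps_deriv f * Y * Y - f * Y * (X * Y')); first by ring.
by rewrite e; ring.
Qed.

Lemma iter_log_deriv (y : {poly {fps K}}) i :
  iter i (@log_deriv K) (map_poly (@FracField.tofrac {fps K}) y) =
  z ^- i *: map_poly (@FracField.tofrac {fps K}) (theta_falling i y).
Proof.
elim: i => [|i IH]; first by rewrite invr1 scale1r.
have laurent_deriv0 : @laurent_deriv K 0 = 0.
  have := laurent_deriv_div_Xn 0 0.
  by rewrite tofrac0 mulr0 mulr0n subr0 raddf0 tofrac0 mulr0.
rewrite iterS IH; apply/polyP => j.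
rewrite /log_deriv coefD coef_map_id0 // coefZ coef_map laurent_deriv_div_Xn.
rewrite coefZ coef_deriv !coefZ !coef_map coefB coefMn coef_log_theta /=.
rewrite exprS invfM -/z -mulrnAr !mulrA -!rmorphMn -mulrDr -rmorphD /=.
by rewrite addrAC.
Qed.

End Expansion.

(** * The differential equation rewritten in theta with coefficients over S *)

Section Descent.
Variables (F K : fieldType) (h : {rmorphism F -> K}) (S : divringClosed K).
Hypothesis hS : forall x, h x \in S.

Lemma ratfun_map0 : ratfun_map h 0 = 0.
Proof.
rewrite -(mul0r (tofrac 1)^-1).
rewrite -[X in X / _](rmorph0 (@FracField.tofrac {poly F})).
rewrite /ratfun_map frac_mapE ?oner_neq0 //; last exact: map_poly_inj.
by rewrite rmorph0 raddf0 mul0r.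
Qed.

Lemma fps_of_map_poly_over p : fps_of_poly (map_poly h p) \in fpsOver S.
Proof. by apply/fpsOverP => m; rewrite /= coef_map hS. Qed.

Lemma fpsX_over : fpsX K \in fpsOver S.
Proof. by apply/fpsOverP => m /=; rewrite rpred_nat. Qed.

(** The fraction given by [regular_at0] has coefficients in [K] only; it yields a power series with
    the right constant term. That this series is over [S] follows from [fpsOver_divr], as [x] is a
    fraction of polynomials over [F]. *)
Lemma regular_expansion (x : ratfun F) (k : int) (c : K) :
    regular_at0 (tofrac 'X ^ k * ratfun_map h x) c ->
  exists b : {fps K}, [/\ b \in fpsOver S, b 0%N = c &
    laurent_of_ratfun (ratfun_map h x) * tofrac (fpsX K) ^ k = tofrac b].
Proof.
have [p [q [q0 ->]]] : exists p q, q != 0 /\ x = tofrac p / tofrac q.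
  exists \n_(repr x), \d_(repr x); split.
    exact: denom_ratioP.
  exact: frac_repr.
(* Moving the negative powers of z across turns the hypothesis into an identity of polynomials. *)
have [a [b ->]] : exists a b : nat, k = a%:Z - b%:Z.
  case: k => k; first by exists k, 0%N; rewrite subr0.
  by exists 0%N, k.+1; rewrite sub0r NegzE.
have hI : injective (map_poly h) by exact: map_poly_inj.
rewrite /ratfun_map frac_mapE //.
have qh0 : map_poly h q != 0 by rewrite -(rmorph0 (map_poly h)) (inj_eq hI).
have iotaI := @fps_of_poly_inj K.
have iota0 u : u != 0 -> @fps_of_poly K u != 0.
  by rewrite -(rmorph0 (@fps_of_poly K)) (inj_eq iotaI).
rewrite /laurent_of_ratfun frac_mapE //.
have zX (A : fieldType) (t : A) : t != 0 -> t ^ (a%:Z - b%:Z) = t ^+ a / t ^+ b.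
  by move=> t0; rewrite expfzDr // exprnN.
rewrite !zX ?tofrac_eq0 ?polyX_eq0 ?fpsX_neq0 //.
set ph := map_poly h p; set qh := map_poly h q.
case=> P [Q [Q0 PQ ->]].
have Qn0 : Q != 0 by apply: contraNneq Q0 => ->; rewrite horner0.
have /(congr1 (@fps_of_poly K)) : 'X^a * ph * Q = P * ('X^b * qh).
  apply/eqP; rewrite -frac_eq ?mulf_neq0 ?expf_neq0 ?polyX_eq0 // -PQ.
  by rewrite !tofracM !tofracXn invfM mulrACA.
rewrite !rmorphM !rmorphXn /= fps_of_polyX.
set iph := fps_of_poly ph; set iqh := fps_of_poly qh.
set iP := fps_of_poly P; set iQ := fps_of_poly Q => e.
have iQU : iQ \is a GRing.unit by rewrite fps_unitE /= -horner_coef0.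
pose be := iP / iQ.
have e2 : be * (fpsX K ^+ b * iqh) = fpsX K ^+ a * iph.
  by rewrite /be mulrAC -e mulrK.
exists be; split.
- apply: (@fpsOver_divr _ _ _ (fpsX K ^+ b * iqh)).
  + by rewrite mulf_neq0 ?expf_neq0 ?fpsX_neq0 ?iota0.
  + by rewrite rpredM ?rpredX ?fpsX_over ?fps_of_map_poly_over.
  + by rewrite e2 rpredM ?rpredX ?fpsX_over ?fps_of_map_poly_over.
- have /(congr1 (fun g : {fps K} => g 0%N)) : be * iQ = iP by rewrite divrK.
  rewrite fps_coef0M /= -!horner_coef0 => <-; by rewrite mulfK.
- rewrite mulf_div -!tofracXn -!tofracM [iph * _]mulrC -e2 [iqh * _]mulrC.
  rewrite tofracM mulfK // tofrac_eq0 mulf_neq0 ?expf_neq0 ?fpsX_neq0 //.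
  exact: iota0.
Qed.

(** Multiplied by z^m, with [m] from the indicial data, a_i d^i becomes z^(m-i) a_i times the
    falling product in theta. The series [b i] expands z^(m-i) a_i, so its constant term is the i-th
    coefficient of [I] in [falling_poly]. *)
Lemma theta_equation (L : {poly ratfun F}) (I : {poly K}) :
    indicial_poly (map_poly (ratfun_map h) L) I ->
  exists N (b : nat -> {fps K}),
    [/\ forall i, (i < N)%N -> b i \in fpsOver S,
        I = \sum_(i < N) b i 0%N *: falling_poly K i &
        forall y, is_solution (map_poly (ratfun_map h) L) y ->
          \sum_(i < N) b i *: theta_falling i y = 0].
Proof.
set L' := map_poly _ L => -[m [c [reg _ Isum]]].
exists (size L').
have /choice[b bP] i : exists b : {fps K}, (i < size L')%N ->
    [/\ b \in fpsOver S, b 0%N = c i &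
      laurent_of_ratfun L'`_i * tofrac (fpsX K) ^ (m - i%:Z) = tofrac b].
  case: ltnP => iL; last by exists 0.
  have := reg i iL; rewrite coef_map_id0; last exact: ratfun_map0.
  by move=> /regular_expansion[b ?]; exists b.
exists b; split=> [i /bP[]||y] //.
  by rewrite Isum; apply: eq_bigr => i _; have [_ -> _] := bP i (ltn_ord i).
rewrite /is_solution (@ore_act_widen _ _ _ (size L')) ?size_poly // => e.
have coefE (M : {poly ratfun K}) (j : 'I_(size M)) :
    (map_poly (@laurent_of_ratfun K) M)`_j = laurent_of_ratfun M`_j.
  by rewrite coef_poly ltn_ord.
have tofracI : injective (@FracField.tofrac {fps K}).
  by move=> f g /eqP; rewrite tofrac_eq => /eqP.
(* The identity is checked in K((z))[ln z], where it is z^m times the equation [e]. *)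
apply: (map_inj_poly tofracI (tofrac0 _)).
rewrite rmorph0 -[RHS](scaler0 _ (tofrac (fpsX K) ^ m)) -e scaler_sumr rmorph_sum.
apply: eq_bigr => i _ /=; rewrite iter_log_deriv !scalerA map_polyZ.
have [_ _ bE] := bP i (ltn_ord i); congr (_ *: _); rewrite -[LHS]bE.
rewrite coefE expfzDr ?tofrac_eq0 ?fpsX_neq0 // exprnN.
by rewrite mulrCA mulrA.
Qed.

End Descent.

(** * Constant changes of basis of a flag, and independence of N_j from them *)

Section Normalise.
Variable K : fieldType.
Implicit Types (d : {fps K}) (f : nat -> {fps K}) (y : nat -> {poly {fps K}}).

(** Here [d] is a series in an auxiliary variable t, not in z: [conv d f] lists the coefficients of
    d(t) \sum_k f_k t^k. *)
Definition conv d f (k : nat) : {fps K} :=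
  \sum_(s < k.+1) fpsC (d s) * f (k - s)%N.

(** In generating form, \sum_k [flag_poly f k] t^k = exp(t ln z) \sum_k f_k t^k, so a factor d(t)
    acts alike on the flag and on its series. *)
Lemma flag_poly_conv d f k :
  flag_poly (conv d f) k = \sum_(s < k.+1) fpsC (d s) *: flag_poly f (k - s)%N.
Proof.
apply/polyP => j; rewrite coef_flag_poly coef_sum; case: leqP => jk; last first.
  rewrite big1 // => s _; rewrite coefZ coef_flag_poly leqNgt.
  by rewrite (leq_ltn_trans (leq_subr _ _) jk) mulr0.
rewrite mulr_sumr (big_ord_widen k.+1 (fun s =>
  fpsC (j`!%:R^-1) * (fpsC (d s) * f (k - j - s)%N))) ?ltnS ?leq_subr //.
rewrite big_mkcond; apply: eq_bigr => s _; rewrite coefZ coef_flag_poly ltnS.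
have -> : (j <= k - s)%N = (s <= k - j)%N.
  by rewrite !leq_subRL // ?[(j + s)%N]addnC // -ltnS.
by case: leqP => _; rewrite ?mulr0 // mulrCA subnAC.
Qed.

Lemma conv_const d f k :
  d * Fps (fun i => f i 0%N) = 1 -> conv d f k 0%N = (k == 0%N)%:R.
Proof.
move=> dE; rewrite -fps_coef1 -dE fps_coefM /conv fps_coef_sum.
by apply: eq_bigr => s _; rewrite fps_coefCM.
Qed.

Lemma theta_falling_is_zmod_morphism i : zmod_morphism (@theta_falling K i).
Proof.
move=> u v; elim: i => //= i ->.
by rewrite raddfB /= mulrnBl !opprB addrACA [in RHS]addrC [- _ + _]addrC; ring.
Qed.

HB.instance Definition _ i := GRing.isZmodMorphism.Build {poly {fps K}}
  {poly {fps K}} (theta_falling i) (theta_falling_is_zmod_morphism i).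

Lemma theta_fallingZC i c (u : {poly {fps K}}) :
  theta_falling i (fpsC c *: u) = fpsC c *: theta_falling i u.
Proof.
by elim: i => //= i ->; rewrite log_thetaZC scalerBr scalerMnr.
Qed.

Hypothesis charK : forall m, m.+1%:R != 0 :> K.

(** The change of basis adds to [y j] only multiples of [y i] with [i < j], which [Nop y j] kills;
    so N_j(y_j), and with it the next operator, is unchanged. *)
Lemma Nop_conv n d f y : f 0%N 0%N = 1 -> d 0%N = 1 ->
    (forall k, (k <= n)%N -> y k = flag_poly f k) ->
  forall j, (j <= n.+1)%N -> Nop (flag_poly (conv d f)) j = Nop y j.
Proof.
move=> f0 d0 yf; elim=> // j IH jn; rewrite /= IH ?(ltnW jn) //.
congr (ore_mul _ _ (ore_mul _ _ _)); congr ((_`_0)^-1)%:P; congr polyseq.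
rewrite flag_poly_conv raddf_sum big_ord_recl big1 /= => [|i _].
  by rewrite theta_actZC d0 subn0 addr0 scale1r yf.
rewrite theta_actZC -yf; last by rewrite (leq_trans (leq_subr _ _)).
have ij : (j - bump 0 i < j)%N by rewrite ltn_subrL (leq_ltn_trans _ (ltn_ord i)).
by rewrite (Nop_flag_eq0 charK f0 yf) ?scaler0 // ltnW.
Qed.

Lemma Nop_over (S : divringClosed K) n N (b : nat -> {fps K}) y f :
    f 0%N 0%N = 1 -> (forall k, (k <= n)%N -> y k = flag_poly f k) ->
    (forall i, (i < N)%N -> b i \in fpsOver S) ->
    (forall m, \sum_(i < N) b i 0%N * (falling_poly K i).[m.+1%:R] != 0) ->
    (forall k, (k <= n)%N -> \sum_(i < N) b i *: theta_falling i (y k) = 0) ->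
  forall j, (j <= n.+1)%N -> Nop y j \in polyOver (fpsOver S).
Proof.
move=> f0 yf bS c0 eq0 j jn.
(* [E] collects the constants f_i(0) as a series in t; convolution with its inverse normalises the
   z^0 part of the flag. *)
pose E : {fps K} := Fps (fun i => f i 0%N).
have dE : E^-1 * E = 1 by rewrite mulVr // fps_unitE /= f0 oner_eq0.
have d0 : E^-1 0%N = 1.
  have := congr1 (fun g : {fps K} => g 0%N) dE.
  by rewrite fps_coef0M fps_coef1 /= f0 mulr1.
rewrite -(Nop_conv f0 d0 yf) //; apply: polyOver_Nop jn => k kn.
apply: (theta_equation_over bS c0).
  rewrite flag_poly_conv.
  rewrite (eq_bigr (fun i : 'I_N => \sum_(s < k.+1)
      fpsC (E^-1 s) *: (b i *: theta_falling i (y (k - s)%N)))); last first.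
    move=> i _; rewrite (raddf_sum (theta_falling i)) scaler_sumr.
    apply: eq_bigr => s _.
    rewrite /= theta_fallingZC !scalerA mulrC yf //.
    by rewrite (leq_trans (leq_subr _ _)).
  rewrite exchange_big big1 // => s _; rewrite -scaler_sumr eq0 ?scaler0 //.
  by rewrite (leq_trans (leq_subr _ _)).
(* Initial data: at z^0 only the top power l = k of ln z survives, with coefficient 1 / l! in
   [S]. *)
move=> l; rewrite coef_flag_poly; case: ifP => _; last first.
  by rewrite fps_coef0 rpred0.
by rewrite fps_coefCM conv_const // rpredM ?rpredV ?rpred_nat.
Qed.

End Normalise.

(** * The rational numbers as a subfield, and the conclusion *)

Section RationalNumbers.
Variable C : numFieldType.

Definition ratr_image : {pred C} := [pred x | `[< exists q : rat, x = ratr q >]].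

Lemma ratr_image_divring : divring_closed ratr_image.
Proof.
split=> [|x y|x y].
- by apply/asboolP; exists 1; rewrite rmorph1.
- move=> /asboolP[p ->] /asboolP[q ->]; apply/asboolP.
  by exists (p - q); rewrite rmorphB.
- move=> /asboolP[p ->] /asboolP[q ->]; apply/asboolP.
  by exists (p / q); rewrite fmorph_div.
Qed.

HB.instance Definition _ := GRing.isDivringClosed.Build C ratr_image
  ratr_image_divring.

Lemma ratr_imageP (P : {poly {fps C}}) : P \in polyOver (fpsOver ratr_image) ->
  exists Q : {poly {fps rat}}, P = map_poly (fps_map (ratr : rat -> C)) Q.
Proof.
move=> /polyOverP PS; have cP j m : exists q : rat, P`_j m = ratr q.
  by have /fpsOverP/(_ m)/asboolP := PS j.
have [q qP] : exists q : nat -> nat -> rat, forall j m, P`_j m = ratr (q j m).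
  have /choice[q qP] j : exists q : nat -> rat, forall m, P`_j m = ratr (q m).
    by have /choice[q qP] := cP j; exists q.
  by exists q.
exists (\poly_(j < size P) Fps (q j)); apply/polyP => j.
rewrite coef_map_id0; last first.
  by apply/fpsP => m; rewrite fps_coef0 /= if_same rmorph0.
rewrite coef_poly; case: ltnP => jP.
  by apply/fpsP => m; rewrite qP.
by rewrite nth_default //; apply/fpsP => m; rewrite fps_coef0 /= if_same rmorph0.
Qed.

End RationalNumbers.

Theorem lemma3p16 (R : realType) (n : nat) (L : {poly ratfun rat})
    (y : nat -> {poly {fps R[i]}}) :
    L \is monic -> size L = n.+2 ->
    ore_irreducible (@ratfun_deriv rat) L ->
    property_M n (complexify R L) ->
    property_P n (complexify R L) ->
    (forall e : R[i], is_exponent (complexify R L) e <-> e = 0) ->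
    flag n (complexify R L) y ->
  [/\ (forall k, (k <= n)%N ->
         exists2 u : {fps R[i]}, u \is a GRing.unit &
           theta_act (Nop y k) (y k) = u%:P),
      (forall j, (j <= n.+1)%N ->
         exists P : {poly {fps rat}},
           Nop y j = map_poly (fps_map (ratr : rat -> R[i])) P)
    & (forall j i, (j <= n.+1)%N -> (i < j)%N ->
         theta_act (Nop y j) (y i) = 0)].
Proof.
move=> _ _ _ [r Ir] _ expo [[sol _ _] [f [f0 yf]]].
have {}yf k : (k <= n)%N -> y k = flag_poly f k by exact: yf.
have charC m : m.+1%:R != 0 :> R[i] by rewrite pnatr_eq0.
split;
  [exact (Nop_flag_unit charC f0 yf) | | exact (Nop_flag_eq0 charC f0 yf)].
move=> j jn; apply: ratr_imageP.
(* By (M), [r] is a root of the indicial polynomial (X - r)^(n+1), hence an exponent. *)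
have r0 : r%:~R = 0 :> R[i].
  apply/expo; exists (('X - r%:~R%:P) ^+ n.+1) => //.
  by rewrite rootE horner_exp hornerXsubC subrr expr0n.
have hS (q : rat) : (ratr q : R[i]) \in @ratr_image R[i].
  by apply/asboolP; exists q.
rewrite r0 subr0 in Ir.
have [N [b [bS Ib eqb]]] := theta_equation hS Ir.
apply: (Nop_over charC f0 yf bS) jn => [m|k kn]; last exact/eqb/sol.
(* The indicial polynomial is now X^(n+1), whose value at [m + 1] is nonzero in characteristic 0. *)
have := congr1 (horner^~ m.+1%:R) Ib.
rewrite hornerXn horner_sum (eq_bigr (fun i : 'I_N =>
  b i 0%N * (falling_poly _ i).[m.+1%:R])).
  by move <-; rewrite expf_neq0.
by move=> i _; rewrite hornerZ.
Qed.
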